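(* Let $0<r<1$ and $1<p<\infty$. Then the space $t_p^r$ has the weak fixed point property.
   Context: Let $\mathbb{N}=\{0,1,2,\dots\}$ and let $\omega$ be the linear space of all (real or complex) sequences $x=(x_k)_{k\in\mathbb{N}}$. For $0<r<1$ the Taylor transform $T(r)x$ of $x\in\omega$ is the sequence with terms $$(T(r)x)_n=\sum_{k=n}^{\infty}\binom{k}{n}(1-r)^{n+1}r^{k-n}x_k\qquad(n\in\mathbb{N}),$$ whenever all these series converge. For $1\le p<\infty$ let $$t_p^r=\Big\{x\in\omega:\ \sum_{n}\Big|\sum_{k=n}^{\infty}\binom{k}{n}(1-r)^{n+1}r^{k-n}x_k\Big|^p<\infty\Big\},$$ equipped with the norm $\|x\|_{t_p^r}=\|T(r)x\|_{\ell_p}$. A Banach space $X$ has the weak fixed point property if every nonexpansive map $f:K\to K$ (that is, $\|f(x)-f(y)\|\le\|x-y\|$ for all $x,y\in K$) on a nonempty weakly compact convex subset $K\subset X$ has a fixed point.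
   Formalization: The stated norm on t_p^r is only a seminorm (T(r) kills some nonzero sequences, e.g. the Taylor coefficients of exp(-(1-z/r)^(-1/2))), so t_p^r is taken as the normed space of its sequences modulo those x with T(r)x = 0. *)

(* Defs.v *)
From HB Require Import structures.
From mathcomp Require Import all_boot all_order all_algebra.
From mathcomp Require Import generic_quotient ring_quotient.
From mathcomp Require Import complex.
From mathcomp Require Import all_classical all_reals all_analysis.

Set Implicit Arguments.
Unset Strict Implicit.
Unset Printing Implicit Defensive.

Import Order.TTheory GRing.Theory Num.Theory.
Import numFieldNormedType.Exports.

Local Open Scope classical_set_scope.
Local Open Scope ring_scope.

Section WeakFixedPointProperty.
Context {K : numFieldType}.
Implicit Type X : normedModType K.

Definition dual X := {phi : {linear X -> K^o} | continuous phi}.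

(* The coarsest topology on X that makes every element of the dual continuous *)
Definition weak_topology X :=
  initial_topology
    (fun x : X => (fun phi : dual X => sval phi x) : {ptws dual X -> K^o}).

Definition weakly_compact X (C : set X) :=
  compact (C : set (weak_topology X)).

Definition nonexpansive_on X (C : set X) (f : X -> X) :=
  forall x y, C x -> C y -> `|f x - f y| <= `|x - y|.

(* A self-map of C is represented by a map on X that sends C into C; its values
   outside C play no role. *)
Definition weak_fixed_point_property X :=
  forall (C : set X) (f : X -> X),
    C !=set0 -> weakly_compact C -> convex_set C ->
    set_fun C C f -> nonexpansive_on C f ->
    exists2 x, C x & f x = x.

End WeakFixedPointProperty.
Arguments weak_fixed_point_property {K} X.

(* The norm of a numFieldType takes its values in the field itself; real powers
   of the modulus need it as an element of R. *)
Record scalars (R : realType) := Scalars {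
  scalar :> numFieldType ;
  ofreal : {rmorphism R -> scalar} ;
  modulus : scalar -> R ;
  modulusE : forall z : scalar, `|z| = ofreal (modulus z) ;
  ler_ofreal : {mono ofreal : a b / a <= b}
}.

Definition real_scalars (R : realType) : scalars R :=
  @Scalars R R idfun Num.norm (fun=> erefl) (fun _ _ => erefl).

Definition complex_scalars (R : realType) : scalars R :=
  @Scalars R R[i] (real_complex R) (@ComplexField.Normc.normc R)
    (fun=> erefl) (@lecR R).

Section ModulusTheory.
Context {R : realType} {F : scalars R}.

Lemma ofreal_inj : injective (@ofreal R F).
Proof.
by move=> a b ab; apply/eqP; rewrite eq_le -!(ler_ofreal F) ab !lexx.
Qed.

Lemma modulus_ge0 (z : F) : 0 <= modulus z.
Proof. by rewrite -(ler_ofreal F) rmorph0 -modulusE. Qed.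

Lemma modulus0 : modulus (0 : F) = 0.
Proof. by apply: ofreal_inj; rewrite -modulusE normr0 rmorph0. Qed.

Lemma modulus_eq0 (z : F) : modulus z = 0 -> z = 0.
Proof. by move=> z0; apply/normr0_eq0; rewrite modulusE z0 rmorph0. Qed.

Lemma modulusM (z w : F) : modulus (z * w) = modulus z * modulus w.
Proof. by apply: ofreal_inj; rewrite rmorphM -!modulusE normrM. Qed.

Lemma ler_modulusD (z w : F) : modulus (z + w) <= modulus z + modulus w.
Proof. by rewrite -(ler_ofreal F) rmorphD -!modulusE ler_normD. Qed.

End ModulusTheory.

Section LpSequences.
Context {R : realType} {F : scalars R}.
Implicit Types (p : R) (y z : nat -> F).

Definition lp_sum p y : \bar R :=
  (\sum_(0 <= n <oo) (modulus (y n) `^ p)%:E)%E.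

Definition lp_norm p y : R := fine (lp_sum p y) `^ p^-1.

Lemma lp_sum_ge0 p y : (0 <= lp_sum p y)%E.
Proof. by apply: nneseries_ge0 => n _ _; rewrite lee_fin powR_ge0. Qed.

Lemma lp_norm_ge0 p y : 0 <= lp_norm p y.
Proof. exact: powR_ge0. Qed.

Let Lnorm_lp p y : 0 < p ->
  'N[@counting nat R]_p%:E[EFin \o (fun n => modulus (y n))]%E
  = (lp_sum p y `^ p^-1)%E.
Proof.
move=> p0; rewrite Lnorm_counting//; congr (_ `^ _)%E.
apply: eq_eseriesr => n _ /=.
by rewrite ger0_norm ?modulus_ge0// poweR_EFin.
Qed.

Let lp_sum_fin p y : (lp_sum p y < +oo)%E -> lp_sum p y \is a fin_num.
Proof. by move=> yp; rewrite ge0_fin_numE ?lp_sum_ge0. Qed.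

Let lp_norm_EFin p y : (lp_sum p y < +oo)%E ->
  (lp_norm p y)%:E = (lp_sum p y `^ p^-1)%E.
Proof.
by move=> yp; rewrite -[in RHS](fineK (lp_sum_fin yp)) poweR_EFin.
Qed.

Lemma lp_sum0 p : 0 < p -> lp_sum p (0 : nat -> F) = 0%E.
Proof.
move=> p0; apply: eseries0 => n _ _ /=.
by rewrite modulus0 powR0 ?gt_eqF.
Qed.

Let minkowski_lp p y z : 1 <= p ->
  (lp_sum p (y \+ z)%R `^ p^-1 <= lp_sum p y `^ p^-1 + lp_sum p z `^ p^-1)%E.
Proof.
move=> p1; have p0 : 0 < p by exact: lt_le_trans p1.
rewrite -!Lnorm_lp//.
apply: le_trans (minkowski_EFin _ _ _ p1) => //.
rewrite Lnorm_lp// Lnorm_counting//.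
apply: gt0_ler_poweR; rewrite ?invr_ge0 ?(ltW p0)//.
- by rewrite in_itv/= lp_sum_ge0 leey.
- rewrite in_itv/= leey andbT; apply: nneseries_ge0 => n _ _.
  by rewrite lee_fin powR_ge0.
- apply: lee_nneseries => [n _ _|n _]; first by rewrite lee_fin powR_ge0.
  rewrite /= ger0_norm ?addr_ge0 ?modulus_ge0// lee_fin.
  rewrite ge0_ler_powR ?nnegrE ?addr_ge0 ?modulus_ge0 ?(ltW p0)//.
  exact: ler_modulusD.
Qed.

Lemma lp_sumD p y z : 1 <= p -> (lp_sum p y < +oo)%E ->
  (lp_sum p z < +oo)%E -> (lp_sum p (y \+ z)%R < +oo)%E.
Proof.
move=> p1 yp zp; have p0 : 0 < p by exact: lt_le_trans p1.
apply: (@lty_poweRy _ _ p^-1); first by rewrite invr_eq0 gt_eqF.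
apply: le_lt_trans (minkowski_lp _ _ p1) _.
by rewrite lte_add_pinfty ?poweR_lty.
Qed.

Lemma ler_lp_normD p y z : 1 <= p -> (lp_sum p y < +oo)%E ->
  (lp_sum p z < +oo)%E -> lp_norm p (y \+ z)%R <= lp_norm p y + lp_norm p z.
Proof.
move=> p1 yp zp; rewrite -lee_fin EFinD.
have yzp := lp_sumD p1 yp zp.
rewrite [leLHS](lp_norm_EFin yzp) [X in (_ <= X + _)%E](lp_norm_EFin yp).
rewrite [X in (_ <= _ + X)%E](lp_norm_EFin zp).
exact: minkowski_lp.
Qed.

Let lp_sumZ_eq p (a : F) y :
  lp_sum p (fun n => a * y n) = ((modulus a `^ p)%:E * lp_sum p y)%E.
Proof.
rewrite /lp_sum -nneseriesZl//; last by move=> n _; rewrite lee_fin powR_ge0.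
by apply: eq_eseriesr => n _; rewrite modulusM powRM ?modulus_ge0// EFinM.
Qed.

Lemma lp_sumZ p (a : F) y : (lp_sum p y < +oo)%E ->
  (lp_sum p (fun n => a * y n)%R < +oo)%E.
Proof.
by move=> yp; rewrite lp_sumZ_eq -(fineK (lp_sum_fin yp)) -EFinM ltry.
Qed.

Lemma lp_normZ p (a : F) y : 0 < p -> (lp_sum p y < +oo)%E ->
  lp_norm p (fun n => a * y n) = modulus a * lp_norm p y.
Proof.
move=> p0 yp; rewrite /lp_norm lp_sumZ_eq fineM//; last exact: lp_sum_fin.
rewrite powRM ?powR_ge0 ?fine_ge0 ?lp_sum_ge0//.
by rewrite -powRrM mulfV ?gt_eqF// powRr1 ?modulus_ge0.
Qed.

End LpSequences.

Section TaylorTransform.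
Context {R : realType} {F : scalars R}.
Implicit Types (r : R) (x : nat -> F^o).

Definition taylor_term r x (n k : nat) : F^o :=
  ofreal F ('C(k, n)%:R * (1 - r) ^+ n.+1 * r ^+ (k - n)) * x k.

Definition taylor_partial r x (n m : nat) : F^o :=
  \sum_(n <= k < m) taylor_term r x n k.

Definition taylor_defined r x := forall n, cvgn (taylor_partial r x n).

Definition taylor r x (n : nat) : F^o := limn (taylor_partial r x n).

Let taylor_partialD r x y n :
  taylor_partial r (x + y) n = taylor_partial r x n + taylor_partial r y n.
Proof.
apply/funext => m.
transitivity (taylor_partial r x n m + taylor_partial r y n m) => //.
by rewrite -big_split; apply: eq_bigr => k _; exact: mulrDr.
Qed.

Let taylor_partialZ r a x n :
  taylor_partial r (a *: x) n = a *: taylor_partial r x n.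
Proof.
apply/funext => m; transitivity (a *: taylor_partial r x n m) => //.
by rewrite scaler_sumr; apply: eq_bigr => k _; exact: mulrCA.
Qed.

Lemma taylor_definedD r x y :
  taylor_defined r x -> taylor_defined r y -> taylor_defined r (x + y).
Proof. by move=> cx cy n; rewrite taylor_partialD; exact: is_cvgD. Qed.

Lemma taylorD r x y : taylor_defined r x -> taylor_defined r y ->
  taylor r (x + y) = (taylor r x \+ taylor r y)%R.
Proof.
by move=> cx cy; apply/funext => n; rewrite /taylor taylor_partialD limD.
Qed.

Lemma taylor_definedZ r a x : taylor_defined r x -> taylor_defined r (a *: x).
Proof. by move=> cx n; rewrite taylor_partialZ; exact: is_cvgZr. Qed.

Lemma taylorZ r a x : taylor_defined r x ->
  taylor r (a *: x) = (fun n => a * taylor r x n).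
Proof.
by move=> cx; apply/funext => n; rewrite /taylor taylor_partialZ limZr.
Qed.

End TaylorTransform.

Section TaylorSequences.
Context {R : realType} (F : scalars R) (r p : R) (p1 : 1 <= p).

(* The inequality 1 <= p is an argument so that the instances below, which use
   Minkowski's inequality, can be inferred from the type. *)
Definition in_taylor of 1 <= p : {pred (nat -> F^o)} :=
  [pred x | `[< taylor_defined r x /\ (lp_sum p (taylor r x) < +oo)%E >]].

Let p0 : 0 < p. Proof. exact: lt_le_trans p1. Qed.

Lemma in_taylorP x :
  reflect (taylor_defined r x /\ (lp_sum p (taylor r x) < +oo)%E)
    (x \in in_taylor p1).
Proof. exact: asboolP. Qed.

Let in_taylor_closed : submod_closed (in_taylor p1).
Proof.
have Z a x : x \in in_taylor p1 -> a *: x \in in_taylor p1.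
  move=> /in_taylorP[dx sx]; apply/in_taylorP; split.
    exact: taylor_definedZ.
  rewrite (taylorZ a dx); exact: (lp_sumZ a sx).
have zero : (0 : nat -> F^o) \in in_taylor p1.
  have t0 n : taylor_partial r (0 : nat -> F^o) n = cst 0.
    apply/funext => m; apply: big1 => k _; rewrite /taylor_term.
    exact: mulr0.
  apply/in_taylorP; split.
    by move=> n; rewrite t0; exact: is_cvg_cst.
  rewrite (_ : taylor r 0 = 0) ?lp_sum0//.
  by apply/funext => n; rewrite /taylor t0 lim_cst.
split=> // a x y /(Z a) /in_taylorP[dx sx] /in_taylorP[dy sy].
apply/in_taylorP; split; first exact: taylor_definedD.
rewrite (taylorD dx dy); exact: (lp_sumD p1 sx sy).
Qed.

HB.instance Definition _ :=
  GRing.isSubmodClosed.Build F (nat -> F^o) (in_taylor p1) in_taylor_closed.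

Definition taylor_seq : Type := {x : nat -> F^o | x \in in_taylor p1}.

HB.instance Definition _ := SubChoice.on taylor_seq.
HB.instance Definition _ := [SubChoice_isSubLmodule of taylor_seq by <:].

Definition taylor_norm (x : taylor_seq) : R := lp_norm p (taylor r (val x)).

Lemma ler_taylor_normD x y :
  taylor_norm (x + y) <= taylor_norm x + taylor_norm y.
Proof.
have /in_taylorP[dx sx] := valP x; have /in_taylorP[dy sy] := valP y.
rewrite /taylor_norm raddfD/= (taylorD dx dy); exact: (ler_lp_normD p1 sx sy).
Qed.

Lemma taylor_normZ a x : taylor_norm (a *: x) = modulus a * taylor_norm x.
Proof.
have /in_taylorP[dx sx] := valP x.
rewrite /taylor_norm linearZ/= (taylorZ a dx); exact: (lp_normZ a p0 sx).
Qed.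

Lemma taylor_norm_ge0 x : 0 <= taylor_norm x.
Proof. exact: lp_norm_ge0. Qed.

Let taylor_norm0 : taylor_norm 0 = 0.
Proof. by rewrite -(scale0r 0) taylor_normZ modulus0 mul0r. Qed.

Let taylor_normN x : taylor_norm (- x) = taylor_norm x.
Proof.
rewrite -scaleN1r taylor_normZ (_ : modulus (-1) = 1) ?mul1r//.
by apply: (@ofreal_inj _ F); rewrite -modulusE normrN1 rmorph1.
Qed.

(* taylor_norm is only a seminorm when 0 < r < 1. The function
   f(z) = exp (- (1 - z / r)^(-1/2)) is smooth on the closed disc |z| <= r and
   all its derivatives vanish at z = r; its Taylor coefficients x_k at 0 thus
   satisfy \sum_(k >= n) 'C(k, n) r^(k - n) x_k = f^(n)(r) / n! = 0 for all n,
   although x <> 0. As for Lebesgue spaces, the normed space therefore consists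
   of the sequences up to differences of norm 0. *)
Definition taylor_null : {pred taylor_seq} := [pred x | taylor_norm x == 0].

Let taylor_null_closed : zmod_closed taylor_null.
Proof.
split=> [|x y]; rewrite !inE; first by rewrite taylor_norm0.
move=> /eqP x0 /eqP y0; rewrite eq_le taylor_norm_ge0 andbT.
by rewrite (le_trans (ler_taylor_normD _ _))// x0 taylor_normN y0 addr0.
Qed.

HB.instance Definition _ :=
  GRing.isZmodClosed.Build taylor_seq taylor_null taylor_null_closed.

Definition taylor_space : Type := {ideal_quot taylor_null}.

HB.instance Definition _ := GRing.Zmodule.on taylor_space.
HB.instance Definition _ := EqQuotient.on taylor_space.

Local Open Scope quotient_scope.

Definition taylor_class (x : taylor_seq) : taylor_space :=
  \pi_({ideal_quot taylor_null}) x.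

Lemma taylor_class_eq x y :
  taylor_class x = taylor_class y <-> taylor_norm (x - y) = 0.
Proof.
rewrite /taylor_class; split.
  by move=> /eqP; rewrite -Quotient.idealrBE inE => /eqP.
by move=> xy; apply/eqP; rewrite -Quotient.idealrBE inE xy.
Qed.

Lemma taylor_class_repr u : taylor_class (repr u) = u.
Proof. exact: reprK. Qed.

Let taylor_classD x y : taylor_class (x + y) = taylor_class x + taylor_class y.
Proof. exact: Quotient.pi_add. Qed.

Definition scale_taylor (a : F) (u : taylor_space) : taylor_space :=
  taylor_class (a *: repr u).

Let scale_class a x : scale_taylor a (taylor_class x) = taylor_class (a *: x).
Proof.
apply/taylor_class_eq; rewrite -scalerBr taylor_normZ.
have /taylor_class_eq -> := taylor_class_repr (taylor_class x).
by rewrite mulr0.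
Qed.

Let scaleA a b u : scale_taylor a (scale_taylor b u) = scale_taylor (a * b) u.
Proof. by rewrite -(taylor_class_repr u) !scale_class scalerA. Qed.

Let scale1 : left_id 1 scale_taylor.
Proof. by move=> u; rewrite -(taylor_class_repr u) !scale_class scale1r. Qed.

Let scaleDr : right_distributive scale_taylor +%R.
Proof.
move=> a u v; rewrite -(taylor_class_repr u) -(taylor_class_repr v).
by rewrite -taylor_classD !scale_class scalerDr taylor_classD.
Qed.

Let scaleDl u : {morph scale_taylor^~ u : a b / a + b}.
Proof.
move=> a b; rewrite -(taylor_class_repr u) !scale_class.
by rewrite scalerDl taylor_classD.
Qed.

HB.instance Definition _ := GRing.Zmodule_isLmodule.Build F taylor_space
  scaleA scale1 scaleDr scaleDl.

Definition taylor_space_norm (u : taylor_space) : F :=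
  ofreal F (taylor_norm (repr u)).

Let taylor_norm_eq x y : taylor_norm (x - y) = 0 ->
  taylor_norm x <= taylor_norm y.
Proof.
move=> xy; have := ler_taylor_normD (x - y) y.
by rewrite subrK xy add0r.
Qed.

Lemma taylor_space_norm_class x :
  taylor_space_norm (taylor_class x) = ofreal F (taylor_norm x).
Proof.
have /taylor_class_eq yx := taylor_class_repr (taylor_class x).
have xy := yx; rewrite -opprB taylor_normN in xy.
apply: (congr1 (ofreal F)); apply: le_anti.
by apply/andP; split; [exact: taylor_norm_eq yx|exact: taylor_norm_eq xy].
Qed.

Let norm_triangle u v :
  taylor_space_norm (u + v) <= taylor_space_norm u + taylor_space_norm v.
Proof.
rewrite -(taylor_class_repr u) -(taylor_class_repr v) -taylor_classD.
by rewrite !taylor_space_norm_class -rmorphD ler_ofreal ler_taylor_normD.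
Qed.

Let norm_scale a u : taylor_space_norm (a *: u) = `|a| * taylor_space_norm u.
Proof.
rewrite -(taylor_class_repr u) [a *: _]scale_class !taylor_space_norm_class.
by rewrite taylor_normZ rmorphM modulusE.
Qed.

Let norm_definite u : taylor_space_norm u = 0 -> u = 0.
Proof.
rewrite -(taylor_class_repr u) taylor_space_norm_class => u0.
have {}u0 : taylor_norm (repr u) = 0.
  by apply: (@ofreal_inj _ F); rewrite u0 rmorph0.
rewrite (_ : 0 = taylor_class 0); last first.
  by rewrite /taylor_class; exact: esym (raddf0 _).
by apply/taylor_class_eq; rewrite subr0.
Qed.

HB.instance Definition _ := Lmodule_isNormed.Build F taylor_space
  norm_triangle norm_scale norm_definite.

Lemma norm_taylor_class x : `|taylor_class x| = ofreal F (taylor_norm x).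
Proof. exact: taylor_space_norm_class. Qed.

End TaylorSequences.

(* Main.v *)
Require Import Defs.
From HB Require Import structures.
From mathcomp Require Import all_boot all_order all_algebra.
From mathcomp Require Import ring lra.
From mathcomp Require Import all_classical all_reals all_analysis.
Set Implicit Arguments.
Unset Strict Implicit.
Unset Printing Implicit Defensive.
Import Order.TTheory GRing.Theory Num.Theory.
Import numFieldNormedType.Exports.
Local Open Scope classical_set_scope.
Local Open Scope ring_scope.

(** The Taylor transform is by definition an isometry of the normed space
onto a linear subspace of l_p, which need not be closed, so the space inherits
the uniform convexity of l_p for 1 < p.

The fixed point comes from the argument of Browder and Goehde
([browder_goehde]): in a uniformly convex space a nonexpansive self-map f of a
convex set C that is bounded and complete for the norm has a fixed point. Take
points x_n of C that f moves by at most 1/(n+1), and minimise over C the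
asymptotic radius limsup |x_n - z|. Uniform convexity makes nearly optimal
centres z close to each other, so there is exactly one optimal centre c; since
f c is at least as good a centre as c, it is c itself.

It remains to see that a weakly compact convex set C is norm bounded and norm
complete. The coordinates of the transform are continuous linear forms, so that
every sequence in C has a cluster point in C for the topology of the seminorms
q_M, the l_p norms of the first M coordinates ([weakly_compact_trunc_norm]). As the norm is the supremum of the q_M, its
closed balls are closed for this coarser topology, and cluster points of Cauchy
sequences are limits ([compact_cauchy_complete]). Boundedness is a gliding hump
argument in which convexity replaces the completeness that the uniform
boundedness principle asks for ([convex_compact_norm_bounded]).

Uniform convexity of l_p is obtained by summing one inequality between scalars
([powR_uniform_convexity]): for every eta > 0 there is K > 0 such that
|a - b|^p <= eta (|a|^p + |b|^p) + K ((|a|^p + |b|^p)/2 - |(a + b)/2|^p).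
The scalars enter only through the parallelogram law of the modulus, which
holds for real and for complex numbers. *)

(** * Strict convexity of powers *)

Section PowerGap.
Context {R : realType} (p : R) (p1 : 1 < p).
Implicit Types a b x t A B D M h : R.

Let p0 : 0 < p. Proof. exact: lt_trans p1. Qed.
Let pn0 : p != 0. Proof. by rewrite gt_eqF. Qed.

Lemma powR_le a b : 0 <= a -> a <= b -> a `^ p <= b `^ p.
Proof.
move=> a0 ab; apply: ge0_ler_powR => //; first exact: ltW.
by rewrite nnegrE (le_trans a0).
Qed.

Lemma powR_divK a t : 0 < t -> 0 <= a -> t `^ p * (a / t) `^ p = a `^ p.
Proof.
move=> t0 a0; rewrite -powRM ?(ltW t0) ?divr_ge0 ?(ltW t0)//.
by rewrite mulrC divfK// gt_eqF.
Qed.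

Lemma powR_bernoulli x : 0 <= x -> 1 + p * (x - 1) <= x `^ p.
Proof.
move=> x0.
have q0 : 0 < p / (p - 1) by rewrite divr_gt0// subr_gt0.
have pq : p^-1 + (p / (p - 1))^-1 = 1.
  by rewrite invf_div; field; rewrite ?pn0 ?subr_eq0 ?gt_eqF ?subr_gt0.
have := conjugate_powR x0 ler01 p0 q0 pq.
rewrite powR1 mulr1 invf_div mul1r => xp; rewrite -subr_ge0.
have -> : x `^ p - (1 + p * (x - 1)) = p * (x `^ p / p + (p - 1) / p - x).
  by field.
by rewrite mulr_ge0 ?(ltW p0)// subr_ge0.
Qed.

Lemma powR_tangent b t : 0 <= b -> 0 < t ->
  t `^ p + p * t `^ (p - 1) * (b - t) <= b `^ p.
Proof.
move=> b0 t0.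
have tn0 : t != 0 by rewrite gt_eqF.
have tp : t `^ p = t * t `^ (p - 1) by rewrite mulr_powRB1// ltW.
have := powR_bernoulli (divr_ge0 b0 (ltW t0)).
rewrite -(ler_pM2l (powR_gt0 p t0)) powR_divK//; apply: le_trans.
rewrite tp le_eqVlt; apply/orP; left; apply/eqP.
by field.
Qed.

(** The gain over the tangent line comes from squaring Bernoulli's inequality
at the square root z of x: (1 + p (z - 1))^2 exceeds 1 + p (z^2 - 1) by
p (p - 1) (z - 1)^2. *)
Lemma powR_bernoulli_gap x : 1 <= x ->
  1 + p * (x - 1) + p * (p - 1) * (Num.sqrt x - 1) ^+ 2 <= x `^ p.
Proof.
move=> x1; have x0 : 0 <= x by exact: le_trans x1.
set z := Num.sqrt x.
have z1 : 1 <= z by rewrite -sqrtr1 ler_sqrt.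
have xz : x = z ^+ 2 by rewrite sqr_sqrtr.
have z0 : 0 <= z by exact: le_trans z1.
have := powR_bernoulli z0.
have b0 : 0 <= 1 + p * (z - 1) by rewrite addr_ge0// mulr_ge0 ?(ltW p0)// subr_ge0.
rewrite -(@ler_sqr _ _ (z `^ p)) ?nnegrE ?powR_ge0// => zp.
have -> : x `^ p = (z `^ p) ^+ 2.
  by rewrite xz expr2 powRM// -expr2.
apply: le_trans zp; rewrite xz le_eqVlt; apply/orP; left; apply/eqP.
by ring.
Qed.

(** Apply the tangent inequality at the midpoint m to both A and B: the linear
terms cancel, and the gain at A / m, which is bounded away from 1, survives. *)
Lemma powR_midpoint_gap h : 0 < h -> h <= 1 ->
  exists2 c, 0 < c & forall A B, 0 <= B -> B <= A -> h * A <= A - B ->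
    ((A + B) / 2) `^ p + c * A `^ p <= (A `^ p + B `^ p) / 2.
Proof.
move=> h0 h1; set w := Num.sqrt (1 + h / 2).
have w1 : 1 < w by rewrite -sqrtr1 ltr_sqrt; lra.
have c0 : 0 < p * (p - 1) * (w - 1) ^+ 2.
  by rewrite mulr_gt0 ?exprn_gt0 ?mulr_gt0// subr_gt0.
exists (p * (p - 1) * (w - 1) ^+ 2 / 2 * 2^-1 `^ p).
  by rewrite mulr_gt0 ?powR_gt0 ?invr_gt0// divr_gt0.
move=> A B B0 BA hA.
have [A0|A0] := ltP 0 A; last first.
  have -> : A = 0 by lra.
  have -> : B = 0 by lra.
  by rewrite addr0 mul0r powR0// mulr0 addr0 mul0r.
set m := (A + B) / 2.
have m0 : 0 < m by rewrite /m; lra.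
have mn0 : m != 0 by rewrite gt_eqF.
have x1 : 1 + h / 2 <= A / m by rewrite ler_pdivlMr// /m; nra.
have := powR_bernoulli_gap (le_trans _ x1); have -> : 1 <= 1 + h / 2 by lra.
move=> /(_ isT) Ap.
have wx : (w - 1) ^+ 2 <= (Num.sqrt (A / m) - 1) ^+ 2.
  rewrite ler_sqr ?nnegrE.
  - by rewrite lerB// ler_wsqrtr.
  - by rewrite subr_ge0 ltW.
  - by rewrite subr_ge0 -sqrtr1 ler_wsqrtr//; lra.
have Bp := powR_bernoulli (divr_ge0 B0 (ltW m0)).
rewrite -(ler_pM2l (powR_gt0 p m0)) powR_divK ?(ltW A0)// in Ap.
rewrite -(ler_pM2l (powR_gt0 p m0)) powR_divK// in Bp.
have := lerD Ap Bp.
have Am : 2^-1 `^ p * A `^ p <= m `^ p.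
  by rewrite -powRM ?invr_ge0 ?(ltW A0)// powR_le ?mulr_ge0 ?invr_ge0 ?(ltW A0)// /m; lra.
have -> : B / m = 2 - A / m by rewrite /m; field; rewrite gt_eqF//; lra.
move=> H.
have mp := powR_gt0 p m0.
have cc : 0 <= p * (p - 1) by rewrite mulr_ge0 ?subr_ge0 ?(ltW p0) ?(ltW p1).
have := ler_wpM2l (ltW mp) (ler_wpM2l cc wx).
have := ler_wpM2l (ltW c0) Am.
move: H; move: (Num.sqrt (A / m)) (A / m) => s k.
move: (m `^ p) (A `^ p) (B `^ p) (2^-1 `^ p) => mm AA BB tt.
move: (p * (p - 1)) => pp; lra.
Qed.

(** Here A, B, M, D stand for |a|, |b|, |(a + b)/2|, |a - b|. When D is not
small with respect to A, either the moduli A and B differ substantially, and the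
strict convexity of the power along the real line gives the gap, or a and b
differ mostly by their argument, and the parallelogram law makes M smaller than
the mean of A and B by a fixed factor. *)
Lemma powR_parallelogram_gap h : 0 < h -> h <= 1 ->
  exists2 c, 0 < c & forall A B D M, 0 <= B -> B <= A -> 0 <= M ->
    A - B <= D -> 4 * M ^+ 2 + D ^+ 2 = 2 * A ^+ 2 + 2 * B ^+ 2 ->
    h * A <= D -> M `^ p + c * A `^ p <= (A `^ p + B `^ p) / 2.
Proof.
move=> h0 h1.
have [||c c0 cP] := @powR_midpoint_gap (h / 2); [lra|lra|].
set th := Num.sqrt (1 - 3 * h ^+ 2 / 16).
have th_ge0 : 0 <= th by exact: sqrtr_ge0.
have th_lt1 : th < 1 by rewrite -sqrtr1 ltr_sqrt//; nra.
have thp : th `^ p < 1.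
  have := @gt0_ltr_powR _ p p0 th 1.
  by rewrite powR1; apply; rewrite ?nnegrE.
exists (Num.min c ((1 - th `^ p) * 2^-1 `^ p)).
  by rewrite lt_min c0 mulr_gt0 ?subr_gt0// powR_gt0// invr_gt0.
move=> A B D M B0 BA M0 ABD para hAD.
have A0 : 0 <= A by exact: le_trans BA.
set m := (A + B) / 2.
have m0 : 0 <= m by rewrite /m; lra.
have le_min_l : Num.min c ((1 - th `^ p) * 2^-1 `^ p) * A `^ p <= c * A `^ p.
  by rewrite ler_wpM2r ?powR_ge0// ge_min lexx.
have le_min_r : Num.min c ((1 - th `^ p) * 2^-1 `^ p) * A `^ p <=
    (1 - th `^ p) * 2^-1 `^ p * A `^ p.
  by rewrite ler_wpM2r ?powR_ge0// ge_min lexx orbT.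
have [hAB|ABh] := lerP (h / 2 * A) (A - B).
  (* the moduli are far apart *)
  have Mm : M `^ p <= m `^ p.
    apply: powR_le => //; rewrite -ler_sqr ?nnegrE// /m; nra.
  have := cP A B B0 BA hAB; rewrite -/m; lra.
(* the moduli are close: 4 M^2 = (2 m)^2 + (A - B)^2 - D^2 with |A - B| <= D / 2 *)
have mp : m `^ p <= (A `^ p + B `^ p) / 2.
  have [->|An0] := eqVneq m 0; first by rewrite powR0// divr_ge0// addr_ge0 ?powR_ge0.
  have mgt0 : 0 < m by rewrite lt_neqAle eq_sym An0.
  have := lerD (powR_tangent A0 mgt0) (powR_tangent B0 mgt0).
  move: (p * _) (m `^ p) (A `^ p) (B `^ p) => k mm AA BB H.
  have : k * (A - m) + k * (B - m) = 0 by rewrite /m; field.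
  by lra.
have Mth : M `^ p <= th `^ p * m `^ p.
  rewrite -powRM//; apply: powR_le => //.
  rewrite -ler_sqr ?nnegrE ?(mulr_ge0 th_ge0 m0)// exprMn sqr_sqrtr; last by nra.
  have mA : m <= A by rewrite /m; lra.
  have : (h * A) ^+ 2 <= D ^+ 2 by rewrite ler_sqr ?nnegrE ?mulr_ge0 ?(ltW h0)//; nra.
  have : m ^+ 2 <= A ^+ 2 by rewrite ler_sqr.
  have : (A - B) ^+ 2 <= (D / 2) ^+ 2 by rewrite ler_sqr ?nnegrE; nra.
  rewrite exprMn => e1 e2 e3.
  have e4 : h ^+ 2 * m ^+ 2 <= D ^+ 2.
    by apply: le_trans e3; rewrite [leRHS]exprMn ler_wpM2l// sqr_ge0.
  have e5 : M ^+ 2 <= m ^+ 2 - 3 * D ^+ 2 / 16.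
    by rewrite expr2 in e1; rewrite /m; nra.
  by lra.
have Am : 2^-1 `^ p * A `^ p <= m `^ p.
  by rewrite -powRM ?invr_ge0// powR_le ?mulr_ge0 ?invr_ge0// /m; lra.
have t1 : 0 <= 1 - th `^ p by rewrite subr_ge0 ltW.
have := ler_wpM2l t1 Am.
lra.
Qed.

(** The form of uniform convexity of the scalars that can be summed over the
coordinates: if D is at most h A, the term with eta dominates D^p; otherwise D
is at most 2 A, and A^p is controlled by the gap. *)
Lemma powR_uniform_convexity eta : 0 < eta ->
  exists2 K, 0 < K & forall A B D M, 0 <= A -> 0 <= B -> 0 <= M ->
    `|A - B| <= D -> D <= A + B ->
    4 * M ^+ 2 + D ^+ 2 = 2 * A ^+ 2 + 2 * B ^+ 2 ->
    D `^ p + K * M `^ p <= (eta + K / 2) * (A `^ p + B `^ p).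
Proof.
move=> e0; set h := Num.min 1 (eta `^ p^-1).
have h0 : 0 < h by rewrite lt_min ltr01 powR_gt0.
have h1 : h <= 1 by rewrite ge_min lexx.
have hp : h `^ p <= eta.
  rewrite -[leRHS](@powRr1 _ eta) ?(ltW e0)// -(mulVf pn0) powRrM powR_le ?(ltW h0)//.
  by rewrite ge_min lexx orbT.
have [c c0 cP] := powR_parallelogram_gap h0 h1.
exists (2 `^ p / c); first by rewrite divr_gt0// powR_gt0.
suff main A B D M : 0 <= B -> B <= A -> 0 <= M -> A - B <= D -> D <= A + B ->
    4 * M ^+ 2 + D ^+ 2 = 2 * A ^+ 2 + 2 * B ^+ 2 ->
    D `^ p + 2 `^ p / c * M `^ p <= (eta + 2 `^ p / c / 2) * (A `^ p + B `^ p).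
  move=> A B D M A0 B0 M0 ABD DAB para.
  have [BA|/ltW AB] := leP B A.
    by apply: main => //; rewrite (le_trans _ ABD)// ler_norm.
  rewrite [A `^ p + _]addrC; apply: main => //.
  - by rewrite (le_trans _ ABD)// distrC ler_norm.
  - by rewrite addrC.
  - by rewrite para addrC.
move=> B0 BA M0 ABD DAB para.
have A0 : 0 <= A by exact: le_trans BA.
have D0 : 0 <= D by lra.
have K0 : 0 <= 2 `^ p / c by rewrite divr_ge0 ?powR_ge0 ?(ltW c0).
have [hAD|/ltW DhA] := lerP (h * A) D.
  have := ler_wpM2l K0 (cP A B D M B0 BA M0 ABD para hAD).
  have : D `^ p <= 2 `^ p * A `^ p by rewrite -powRM// powR_le//; lra.
  have -> : 2 `^ p / c * (M `^ p + c * A `^ p) =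
    2 `^ p / c * M `^ p + 2 `^ p * A `^ p by field; rewrite gt_eqF.
  have : 0 <= eta * (A `^ p + B `^ p) by rewrite mulr_ge0 ?addr_ge0 ?powR_ge0 ?(ltW e0).
  by lra.
have Dp : D `^ p <= eta * A `^ p.
  apply: (@le_trans _ _ (h `^ p * A `^ p)); last by rewrite ler_wpM2r// powR_ge0.
  by rewrite -powRM ?(ltW h0)// powR_le.
have eB : 0 <= eta * B `^ p by rewrite mulr_ge0 ?powR_ge0 ?(ltW e0).
have Mp : M `^ p <= (A `^ p + B `^ p) / 2.
  have [->|Mn0] := eqVneq M 0; first by rewrite powR0// divr_ge0// addr_ge0 ?powR_ge0.
  have Mgt0 : 0 < M by rewrite lt_neqAle eq_sym Mn0.
  have := lerD (powR_tangent A0 Mgt0) (powR_tangent B0 Mgt0).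
  have MAB : 0 <= A + B - 2 * M.
    by rewrite subr_ge0 -ler_sqr ?nnegrE ?mulr_ge0 ?addr_ge0//; nra.
  have : 0 <= p * M `^ (p - 1) * (A + B - 2 * M).
    by rewrite !mulr_ge0 ?powR_ge0 ?(ltW p0).
  move: (p * _) (M `^ p) (A `^ p) (B `^ p) => k mm AA BB; lra.
have := ler_wpM2l K0 Mp.
lra.
Qed.

End PowerGap.

(** * Fixed points in uniformly convex spaces *)

Lemma convex_setP (K : numDomainType) (M : lmodType K) (A : set M) :
  convex_set A <->
  forall x y t, A x -> A y -> 0 <= t -> t <= 1 -> A (t *: x + (1 - t) *: y).
Proof.
split=> [cA x y t Ax Ay t0 t1|cA x y l /set_mem Ax /set_mem Ay].
  have := cA x y (Itv01 t0 t1) (mem_set Ax) (mem_set Ay).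
  by move=> /set_mem.
by apply/mem_set; exact: cA.
Qed.

Section BrowderGoehde.
Context {R : realType} {E : normedModType R}.
Implicit Types (C : set E) (f : E -> E) (x : nat -> E).

(** Equivalent to the usual definition on the unit ball by homogeneity. The
thickness d of the shell depends on its radius s, which saves rescaling; for
s = 0 the triangle inequality is enough. *)
Definition uniformly_convex := forall s e : R, 0 <= s -> 0 < e ->
  exists2 d, 0 < d & forall u v : E, `|u| <= s + d -> `|v| <= s + d ->
    s - d <= `|2^-1 *: (u + v)| -> `|u - v| <= e.

Definition norm_bounded C := exists D : R, forall u, C u -> `|u| <= D.

(** Phrased with sequences, because the ambient space is not assumed to be
complete. *)
Definition cauchy_complete C := forall x, (forall n, C (x n)) ->
  (forall e, 0 < e ->
    exists k, forall i j, (k <= i)%N -> (k <= j)%N -> `|x i - x j| <= e) ->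
  exists2 c, C c &
    forall e, 0 < e -> exists k, forall i, (k <= i)%N -> `|x i - c| <= e.

(** Consecutive iterates of the contraction g = t a + (1 - t) f are eventually
arbitrarily close, which replaces a fixed point of g when C is not complete, and
g is uniformly close to f when t is small. *)
Lemma near_fixed_point C f e : C !=set0 -> convex_set C -> norm_bounded C ->
  set_fun C C f -> nonexpansive_on C f -> 0 < e ->
  exists2 y, C y & `|y - f y| <= e.
Proof.
move=> [a Ca] /convex_setP cC [D0 CD0] Cf nf e0.
pose D := 2 * `|D0| + 1.
have D_gt0 : 0 < D by rewrite ltr_wpDl// mulr_ge0.
have CD u v : C u -> C v -> `|u - v| <= D.
  move=> /CD0 uD /CD0 vD; rewrite (le_trans (ler_normB _ _))// /D.
  by have := ler_norm D0; lra.
pose t := e / (e + 2 * D).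
have De : 0 < e + 2 * D by lra.
have t0 : 0 < t by rewrite divr_gt0.
have t1 : t < 1 by rewrite ltr_pdivrMr//; lra.
have tD : t * D <= e / 2.
  by rewrite mulrAC ler_pdivrMr//; have := mulr_gt0 e0 e0; lra.
pose g u := t *: a + (1 - t) *: f u.
have Cg u : C u -> C (g u) by move=> Cu; apply: cC => //; [exact: Cf|lra|lra].
have Cgn n : C (iter n g a) by elim: n => //= n /Cg.
have gn n : `|iter n.+1 g a - iter n g a| <= (1 - t) ^+ n * D.
  elim: n => [|n IH]; first by rewrite expr0 mul1r CD//; exact: Cg.
  have -> : iter n.+2 g a - iter n.+1 g a =
      (1 - t) *: (f (iter n.+1 g a) - f (iter n g a)).
    by rewrite /= {1 3}/g opprD addrACA subrr add0r -scalerBr.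
  rewrite normrZ gtr0_norm ?subr_gt0//.
  rewrite exprS -mulrA ler_pM2l ?subr_gt0//.
  by apply: le_trans IH; exact: nf (Cgn n.+1) (Cgn n).
have [n nP] : exists n, (1 - t) ^+ n * D <= e / 2.
  have : `|1 - t| < 1 by rewrite gtr0_norm; lra.
  move=> /cvg_expr /cvgrPdist_le /(_ (e / 2 / D)).
  move=> []; first by rewrite !divr_gt0.
  move=> n _ /(_ n (leqnn n)) /=; rewrite sub0r normrN ger0_norm.
    by rewrite ler_pdivlMr// => ?; exists n.
  by rewrite exprn_ge0// subr_ge0 ltW.
exists (iter n g a); first exact: Cgn.
set y := iter n g a.
have gy : g y - f y = t *: (a - f y).
  by rewrite /g scalerBl scale1r addrA addrAC addrK scalerBr.
have := ler_distD (g y) y (f y); rewrite gy.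
have : `|t *: (a - f y)| <= t * D.
  by rewrite normrZ gtr0_norm// ler_pM2l// CD//; exact/Cf/Cgn.
have := gn n; rewrite -/y [iter n.+1 g a]/= -/y [`|g y - y|]distrC.
lra.
Qed.

(** Every point of C is a centre of a ball that contains a tail of an
approximate fixed point sequence x. If s is the infimum of the radii, then two
centres of radius close to s must be close to each other: otherwise their
midpoint would have a radius less than s. *)
Lemma browder_goehde C f : uniformly_convex -> C !=set0 -> convex_set C ->
  norm_bounded C -> cauchy_complete C ->
  set_fun C C f -> nonexpansive_on C f -> exists2 c, C c & f c = c.
Proof.
move=> uc C0 cC bC kC Cf nf.
have [x Px] : {x : nat -> E &
    forall n, C (x n) /\ `|x n - f (x n)| <= n.+1%:R^-1}.
  apply: (@choice _ _ (fun n y => C y /\ `|y - f y| <= n.+1%:R^-1)) => n.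
  have [|y Cy yP] := near_fixed_point C0 cC bC Cf nf (e := n.+1%:R^-1).
    by rewrite invr_gt0.
  by exists y.
have Cx n : C (x n) by have [] := Px n.
have small d : 0 < d -> exists k, forall i, (k <= i)%N -> i.+1%:R^-1 <= d :> R.
  move=> d0; exists (Num.truncn d^-1) => n kn.
  by rewrite invf_ple ?posrE// (le_trans (ltW (truncnS_gt _)))// ler_nat.
have xf e : 0 < e -> exists k, forall n, (k <= n)%N -> `|x n - f (x n)| <= e.
  move=> /small[k kP]; exists k => n /kP; apply: le_trans.
  by have [] := Px n.
pose tail (z : E) (s : R) := exists k, forall n, (k <= n)%N -> `|x n - z| <= s.
have tailW z s s' : s <= s' -> tail z s -> tail z s'.
  by move=> ss' [k kP]; exists k => n /kP /le_trans; apply.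
pose S := [set s : R | exists2 z, C z & tail z s].
have [D CD] := bC.
have S0 : S !=set0.
  have [a Ca] := C0; exists (2 * D); exists a => //; exists 0%N => n _.
  by rewrite (le_trans (ler_normB _ _))//; have := CD _ Ca; have := CD _ (Cx n); lra.
have Slb : lbound S 0.
  by move=> s [z _ [k /(_ k (leqnn k))]]; exact: le_trans.
have Sinf : has_inf S by split => //; exists 0.
set s := inf S.
have s_ge0 : 0 <= s by exact: lb_le_inf.
have sP z s' : C z -> tail z s' -> s <= s'.
  by move=> Cz zs'; apply: ge_inf; [exact: Sinf.2|exists z].
(* centres that are almost optimal are close to each other *)
have close e : 0 < e -> exists2 d, 0 < d & forall z w, C z -> C w ->
    tail z (s + d) -> tail w (s + d) -> `|z - w| <= e.
  move=> e0; have [d d0 dP] := uc s e s_ge0 e0.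
  exists d => // z w Cz Cw [k kP] [l lP].
  have Cm : C (2^-1 *: (z + w)).
    rewrite scalerDr; have -> : 2^-1 *: w = (1 - 2^-1) *: w.
      by congr (_ *: _); lra.
    by move/convex_setP: cC; apply => //; lra.
  have [n [kn ln sn]] : exists n,
      [/\ (k <= n)%N, (l <= n)%N & s - d <= `|x n - 2^-1 *: (z + w)|].
    apply: contrapT => /forallNP H.
    suff : tail (2^-1 *: (z + w)) (s - d) by move/(sP _ _ Cm); lra.
    exists (maxn k l) => n; rewrite geq_max => /andP[kn ln].
    by rewrite leNgt; apply/negP => /ltW sn; apply: (H n).
  have -> : z - w = (x n - w) - (x n - z) by rewrite opprB [RHS]addrC subrKA.
  apply: dP; [exact: lP|exact: kP|].
  rewrite (_ : _ + _ = 2 *: x n - (z + w)).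
    by rewrite scalerBr scalerA mulVf// scale1r.
  by rewrite addrACA -opprD [w + z]addrC scaler_nat mulr2n.
(* a minimising sequence of centres is Cauchy; its limit c is optimal *)
have [z zP] : {z : nat -> E &
    forall k, C (z k) /\ tail (z k) (s + k.+1%:R^-1)}.
  apply: (@choice _ _ (fun k z => C z /\ tail z (s + k.+1%:R^-1))) => k.
  have [||s' [w Cw ws'] s's] := @inf_adherent _ S k.+1%:R^-1 => //.
  by exists w; split => //; apply: tailW ws'; exact: ltW.
have [||c Cc zc] := kC z; first by move=> n; have [] := zP n.
  move=> e /close[d d0 dP]; have [k kP] := small d d0.
  exists k => i j ki kj; have [Ci ti] := zP i; have [Cj tj] := zP j.
  apply: dP => //; [apply: tailW ti|apply: tailW tj]; by rewrite lerD2l kP.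
have ct d : 0 < d -> tail c (s + d).
  move=> d0; have d20 : 0 < d / 2 by rewrite divr_gt0.
  have [k kP] := small _ d20; have [l lP] := zc _ d20.
  have [_ [j jP]] := zP (maxn k l).
  exists j => n /jP xz; have := lP _ (leq_maxr k l); have := kP _ (leq_maxl k l).
  have := ler_distD (z (maxn k l)) (x n) c.
  by move: xz; move: (_.+1%:R^-1) => v; lra.
(* f c is also optimal, because f nearly fixes x n *)
have fct d : 0 < d -> tail (f c) (s + d).
  move=> d0; have d20 : 0 < d / 2 by rewrite divr_gt0.
  have [k kP] := ct _ d20; have [l lP] := xf _ d20.
  exists (maxn k l) => n; rewrite geq_max => /andP[/kP kn /lP ln].
  have := ler_distD (f (x n)) (x n) (f c); have := nf _ _ (Cx n) Cc; lra.
exists c => //; apply/eqP; rewrite -subr_eq0 -normr_le0; apply/ler_addgt0Pl => e e0.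
have [d d0 dP] := close _ e0.
by rewrite addr0; apply: dP; [exact: Cf|exact: Cc|exact: fct|exact: ct].
Qed.

End BrowderGoehde.

Arguments uniformly_convex {R} E.

(** If |u| and |v| are at most s + d and |(u + v)/2| is at least s - d, the
hypothesis bounds |u - v|^p by about 2 eta s^p plus K times the variation of
the power on [s - d, s + d]. First eta is chosen, then d according to K. *)
Lemma uniformly_convex_powR (R : realType) (E : normedModType R) (p : R) :
  1 < p ->
  (forall eta, 0 < eta -> exists2 K, 0 < K & forall u v : E,
    `|u - v| `^ p + K * `|2^-1 *: (u + v)| `^ p <=
    (eta + K / 2) * (`|u| `^ p + `|v| `^ p)) ->
  uniformly_convex E.
Proof.
move=> p1 H s e s0 e0; have p0 : 0 < p by exact: lt_trans p1.
set t := (s + 1) `^ p; set e' := e `^ p.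
have s1 : 0 < s + 1 by lra.
have t0 : 0 < t by exact: powR_gt0.
have e'0 : 0 < e' by exact: powR_gt0.
have [K K0 HK] := H (e' / (4 * t)) (divr_gt0 e'0 (mulr_gt0 (ltr0n _ 4) t0)).
set k := K * (p * (s + 1) `^ (p - 1)).
have k0 : 0 <= k by rewrite !mulr_ge0 ?powR_ge0 ?(ltW K0) ?(ltW p0).
pose d := Num.min 1 (e' / (4 * k + 1)).
have k1 : 0 < 4 * k + 1 by rewrite ltr_wpDl// mulr_ge0.
have d0 : 0 < d by rewrite lt_min ltr01 divr_gt0.
have d1 : d <= 1 by rewrite ge_min lexx.
have dk : 4 * k * d <= e'.
  have : d * (4 * k + 1) <= e' by rewrite -ler_pdivlMr// ge_min lexx orbT.
  by move/(le_trans _); apply; rewrite [leRHS]mulrDr mulrC mulr1 lerDl ltW.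
exists d => // u v ud vd; set m := 2^-1 *: (u + v) => md.
have sd0 : 0 < s + d by lra.
have sd1 : s + d <= s + 1 by lra.
have pow_le a b : 0 <= a -> a <= b -> a `^ p <= b `^ p by exact: powR_le.
have up := pow_le _ _ (normr_ge0 u) ud.
have vp := pow_le _ _ (normr_ge0 v) vd.
have sdt : (s + d) `^ p <= t by apply: pow_le => //; exact: ltW.
have := powR_tangent p1 (normr_ge0 m) sd0.
have slope : (s + d) `^ (p - 1) <= (s + 1) `^ (p - 1).
  by apply: ge0_ler_powR => //; rewrite ?nnegrE ?subr_ge0; exact: ltW.
(* the tangent at s + d bounds how much the power decreases down to |m| *)
have drop : - (2 * d * (p * (s + 1) `^ (p - 1))) <=
    p * (s + d) `^ (p - 1) * (`|m| - (s + d)).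
  have -> : p * (s + d) `^ (p - 1) * (`|m| - (s + d)) =
     - (((s + d) - `|m|) * (p * (s + d) `^ (p - 1))) by ring.
  rewrite lerN2; apply: (@le_trans _ _ (2 * d * (p * (s + d) `^ (p - 1)))).
    by rewrite ler_wpM2r ?mulr_ge0 ?powR_ge0 ?(ltW p0)//; lra.
  by rewrite ler_wpM2l ?mulr_ge0 ?(ltW d0)// ler_wpM2l// ltW.
move=> tan; have Km := ler_wpM2l (ltW K0) (le_trans (lerD (lexx _) drop) tan).
have HKuv := HK u v; rewrite -/m in HKuv.
have c0 : 0 <= e' / (4 * t) + K / 2.
  by rewrite addr_ge0// divr_ge0 ?mulr_ge0 ?(ltW e'0) ?(ltW t0) ?(ltW K0).
have := ler_wpM2l c0 (lerD up vp).
have : e' / (4 * t) * ((s + d) `^ p + (s + d) `^ p) <= e' / 2.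
  have -> : e' / 2 = e' / (4 * t) * (t + t) by field; rewrite gt_eqF.
  rewrite ler_wpM2l ?lerD//.
  by rewrite divr_ge0 ?mulr_ge0 ?(ltW e'0) ?(ltW t0).
move: Km; rewrite mulrDr mulrN.
have -> : K * (2 * d * (p * (s + 1) `^ (p - 1))) = 2 * k * d by rewrite /k; ring.
move=> Km h1 h2.
have uvp : `|u - v| `^ p <= e `^ p by rewrite -/e'; lra.
rewrite leNgt; apply/negP => euv; move: uvp; apply/negP; rewrite -ltNge.
by apply: gt0_ltr_powR => //; rewrite nnegrE// ltW.
Qed.

(** * Norms exhausted by compact seminorms *)

Section ExhaustingSeminorms.
Context {R : realType} {E : normedModType R} (q : nat -> E -> R).
Context (qD : forall M u v, q M (u + v) <= q M u + q M v).
Context (qZ : forall M (a : R) u, q M (a *: u) = `|a| * q M u).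
Context (q_le_norm : forall M u, q M u <= `|u|).
Context (q_mono : forall M M' u, (M <= M')%N -> q M u <= q M' u).
Context (norm_le_q : forall u (s : R), (forall M, q M u <= s) -> `|u| <= s).

(** Sequential compactness for the topology of the seminorms, stated with
cluster points, which suffice and are what weak compactness provides. *)
Definition seminorms_compact (C : set E) :=
  forall x : nat -> E, (forall j, C (x j)) -> exists2 c, C c &
    forall M (e : R) k, 0 < e -> exists2 j, (k <= j)%N & q M (x j - c) < e.

Let qN M u : q M (- u) = q M u.
Proof. by rewrite -scaleN1r qZ normrN1 mul1r. Qed.

(** Balls are closed for the topology of the seminorms, so a cluster point of a
tail of a Cauchy sequence lies as close to this tail as its diameter. *)
Lemma compact_cauchy_complete (C : set E) :
  seminorms_compact C -> cauchy_complete C.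
Proof.
move=> cC x Cx cauchy_x; have [c Cc xc] := cC x Cx; exists c => // e e0.
have e20 : 0 < e / 2 by rewrite divr_gt0.
have [k kP] := cauchy_x _ e20; exists k => i ki.
apply: norm_le_q => M; have [j kj jP] := xc M _ k e20.
have := qD M (x i - x j) (x j - c); rewrite subrKA => /le_trans; apply.
have := q_le_norm M (x i - x j); have := kP i j ki kj; lra.
Qed.

Let compact_bounded_q (C : set E) M : seminorms_compact C ->
  exists2 B, 0 < B & forall u, C u -> q M u <= B.
Proof.
move=> cC; apply: contrapT => H.
have [x xP] : {x : nat -> E & forall n, C (x n) /\ n%:R < q M (x n)}.
  apply: (@choice _ _ (fun n u => C u /\ n%:R < q M u)) => n.
  apply: contrapT => nP; apply: H; exists (n%:R + 1); first by rewrite ltr_wpDl.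
  move=> u Cu; rewrite leNgt; apply/negP => un; apply: nP; exists u; split => //.
  by apply: lt_trans un; rewrite ltrDl.
have [c _ /(_ M 1 (Num.truncn (q M c + 1)).+1 ltr01)] := cC x (fun n => (xP n).1).
move=> [j kj jP]; have [_ xj] := xP j.
have := truncnS_gt (q M c + 1); have : (Num.truncn (q M c + 1)).+1%:R <= j%:R :> R.
  by rewrite ler_nat.
have := qD M (x j - c) c; rewrite subrK.
move: xj; move: (j%:R) (_.+1%:R) => a b; lra.
Qed.

(** Suppose that C is unbounded. Since each q M is bounded on C, a point x of C
can be moved towards a point of huge norm by a step that is tiny for q M but
makes the norm, hence some q M', large. Iterating, the points x n keep the large
value of q (M j) acquired when M j is chosen, up to a bounded error, so a cluster point
in C would have infinite norm. *)
Lemma convex_compact_norm_bounded (C : set E) :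
  convex_set C -> seminorms_compact C -> norm_bounded C.
Proof.
move=> /convex_setP cvC cC; apply: contrapT => unbounded.
have far (b : R) : exists2 u, C u & b < `|u|.
  apply: contrapT => /forall2NP H; apply: unbounded; exists b => u Cu.
  by case: (H u) => // /negP; rewrite -leNgt.
(* the state (k, (x, M)) records the stage, the point and the current seminorm *)
have step (s : nat * (E * nat)) : exists s' : nat * (E * nat),
    C s.2.1 -> [/\ s'.1 = s.1.+1, C s'.2.1, (s.2.2 <= s'.2.2)%N,
      q s.2.2 (s'.2.1 - s.2.1) <= 2^-1 ^+ s.1 & s.1%:R < q s'.2.2 s'.2.1].
  case: s => k [x M] /=.
  have [Cx|nCx] := pselect (C x); last by exists (k, (x, M)).
  have [B B0 qB] := compact_bounded_q M cC.
  pose t := 2^-1 ^+ k / (2 * B + 1).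
  have B1 : 0 < 2 * B + 1 by lra.
  have pk : 0 < 2^-1 ^+ k :> R by rewrite exprn_gt0// invr_gt0.
  have pk1 : 2^-1 ^+ k <= 1 :> R by rewrite exprn_ile1// invf_le1// ler1n.
  have t0 : 0 < t by rewrite divr_gt0.
  have t1 : t <= 1 by rewrite ler_pdivrMr//; lra.
  have tB : t * (2 * B) <= 2^-1 ^+ k.
    by rewrite mulrAC ler_pdivrMr// ler_pM2l//; lra.
  have [u Cu uP] := far ((k%:R + `|x|) / t).
  pose y := t *: u + (1 - t) *: x.
  have Cy : C y by apply: cvC => //; exact: ltW.
  have yx : y - x = t *: (u - x).
    by rewrite /y scalerBl scale1r scalerBr addrA addrAC addrK.
  have ky : k%:R < `|y|.
    rewrite ltr_pdivrMr// in uP.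
    have : `|t *: u| <= `|y| + `|(1 - t) *: x|.
      by rewrite -[X in `|X|](addrK ((1 - t) *: x)) ler_normB.
    have -> : `|t *: u| = t * `|u| by rewrite normrZ gtr0_norm.
    have -> : `|(1 - t) *: x| = (1 - t) * `|x|.
      by rewrite normrZ ger0_norm ?subr_ge0.
    have : t * `|x| >= 0 by rewrite mulr_ge0// ltW.
    by lra.
  have [M' kM'] : exists M', k%:R < q M' y.
    apply: contrapT => /forallNP H; move: ky; apply/negP; rewrite -leNgt.
    by apply: norm_le_q => M'; rewrite leNgt; apply/negP/H.
  exists (k.+1, (y, maxn M M')) => _; split => //=.
  - exact: leq_maxl.
  - rewrite yx qZ gtr0_norm// (le_trans _ tB)// ler_pM2l//.
    by have := qD M u (- x); rewrite qN; have := qB _ Cu; have := qB _ Cx; lra.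
  - by rewrite (lt_le_trans kM')// q_mono// leq_maxr.
have [F FP] := choice step.
have [a Ca _] := far 0.
pose s n := iter n F (0%N, (a, 0%N)).
have Cs n : C (s n).2.1.
  by elim: n => //= n /FP[].
have sn n : (s n).1 = n.
  by elim: n => //= n IH; have [-> _ _ _ _] := FP _ (Cs n); rewrite IH.
pose x n := (s n).2.1; pose M n := (s n).2.2.
have Mx n : [/\ (M n <= M n.+1)%N, q (M n) (x n.+1 - x n) <= 2^-1 ^+ n &
    n%:R < q (M n.+1) (x n.+1)].
  by have [_ _] := FP _ (Cs n); rewrite sn.
have Mmono : {homo M : i j / (i <= j)%N}.
  by apply: homo_leq => //[? ? ?|n]; [exact: leq_trans|have [] := Mx n].
(* the geometric steps after stage j sum up to at most 2 *)
have drift j i : q (M j) (x (j + i)%N - x j) <= 2 - 2 * 2^-1 ^+ i.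
  elim: i => [|i IH].
    by rewrite addn0 subrr expr0 -(scale0r 0) qZ normr0 mul0r; lra.
  rewrite addnS.
  have := qD (M j) (x (j + i).+1 - x (j + i)%N) (x (j + i)%N - x j).
  rewrite subrKA => /le_trans; apply.
  have [_ h _] := Mx (j + i)%N.
  have := q_mono (x (j + i).+1 - x (j + i)%N) (Mmono _ _ (leq_addr i j)).
  have : 2^-1 ^+ (j + i) <= 2^-1 ^+ i :> R.
    by rewrite ler_iXn2l// ?invf_lt1 ?ltr1n ?leq_addl.
  rewrite exprS; lra.
have [c Cc xc] := cC x Cs.
pose j := (Num.truncn (`|c| + 3)).+1.
have [i ji iP] := xc (M j.+1) 1 j.+1 ltr01.
have [_ _ xj] := Mx j.
have := drift j.+1 (i - j.+1)%N; rewrite subnKC// => dr.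
have := qD (M j.+1) (x j.+1 - x i) (x i).
rewrite subrK -[q _ (x j.+1 - x i)]qN opprB.
have := qD (M j.+1) (x i - c) c; rewrite subrK.
have := q_le_norm (M j.+1) c.
have : 0 < 2^-1 ^+ (i - j.+1) :> R by rewrite exprn_gt0// invr_gt0.
have := truncnS_gt (`|c| + 3); rewrite -/j.
move: xj; move: (j%:R) => jj.
lra.
Qed.

End ExhaustingSeminorms.

(** * Truncation and uniform convexity in l_p *)

Definition parallelogram_law (R : realType) (F : scalars R) := forall a b : F,
  modulus (a + b) ^+ 2 + modulus (a - b) ^+ 2 =
  2 * modulus a ^+ 2 + 2 * modulus b ^+ 2.

Lemma modulus_ofreal (R : realType) (F : scalars R) (a : R) :
  modulus (ofreal F a) = `|a|.
Proof.
apply: (@ofreal_inj _ F); rewrite -modulusE.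
have [a0|a0] := ger0P a; first by rewrite ger0_norm// -(rmorph0 (ofreal F)) ler_ofreal.
by rewrite ler0_norm ?rmorphN// -(rmorph0 (ofreal F)) ler_ofreal ltW.
Qed.

Lemma modulusB (R : realType) (F : scalars R) (a b : F) :
  modulus (a - b) = modulus (b - a).
Proof. by apply: (@ofreal_inj _ F); rewrite -!modulusE distrC. Qed.

Section TruncatedNorms.
Context {R : realType} {F : scalars R} (p : R) (p1 : 1 <= p).
Implicit Types y z : nat -> F.

Let p0 : 0 < p. Proof. exact: lt_le_trans p1. Qed.
Let pn0 : p != 0. Proof. by rewrite gt_eqF. Qed.

Let term_ge0 y n : (0 <= (modulus (y n) `^ p)%:E)%E.
Proof. by rewrite lee_fin powR_ge0. Qed.

Lemma lp_sum_fin_num y : (lp_sum p y < +oo)%E -> lp_sum p y \is a fin_num.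
Proof. by move=> yp; rewrite ge0_fin_numE ?lp_sum_ge0. Qed.

Lemma lp_norm_powR y : lp_norm p y `^ p = fine (lp_sum p y).
Proof.
by rewrite -powRrM mulVf// powRr1// fine_ge0// lp_sum_ge0.
Qed.

Lemma ler_lp_sum y z : (forall n, modulus (y n) <= modulus (z n)) ->
  (lp_sum p y <= lp_sum p z)%E.
Proof.
move=> yz; apply: lee_nneseries => [n _ _|n _]; first exact: term_ge0.
by rewrite lee_fin ge0_ler_powR ?nnegrE ?modulus_ge0 ?(ltW p0).
Qed.

Lemma ler_lp_norm y z : (lp_sum p z < +oo)%E ->
  (forall n, modulus (y n) <= modulus (z n)) -> lp_norm p y <= lp_norm p z.
Proof.
move=> zp /ler_lp_sum yz; apply: ge0_ler_powR; rewrite ?invr_ge0 ?(ltW p0)//.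
- by rewrite nnegrE fine_ge0// lp_sum_ge0.
- by rewrite nnegrE fine_ge0// lp_sum_ge0.
- by rewrite fine_le// lp_sum_fin_num// (le_lt_trans yz).
Qed.

Definition lp_trunc M y : nat -> F := fun n => if (n < M)%N then y n else 0.

Lemma lp_sum_trunc M y :
  lp_sum p (lp_trunc M y) = (\sum_(0 <= n < M) modulus (y n) `^ p)%:E.
Proof.
rewrite /lp_sum (nneseries_split 0 M) => [|n _]; last exact: term_ge0.
rewrite [X in (_ + X)%E]eseries0 ?adde0; last first.
  by move=> n Mn _; rewrite /lp_trunc ltnNge Mn/= modulus0 powR0.
rewrite add0n -sumEFin; apply: eq_big_nat => n /andP[_ nM].
by rewrite /lp_trunc nM.
Qed.

Lemma lp_sum_trunc_lty M y : (lp_sum p (lp_trunc M y) < +oo)%E.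
Proof. by rewrite lp_sum_trunc ltry. Qed.

Lemma lp_truncD M y z : lp_trunc M (y \+ z) = lp_trunc M y \+ lp_trunc M z.
Proof. by apply/funext => n; rewrite /lp_trunc/=; case: ifP; rewrite ?addr0. Qed.

Lemma lp_truncZ M a y : lp_trunc M (fun n => a * y n) = fun n => a * lp_trunc M y n.
Proof. by apply/funext => n; rewrite /lp_trunc; case: ifP; rewrite ?mulr0. Qed.

Lemma modulus_trunc M y n : modulus (lp_trunc M y n) <= modulus (y n).
Proof. by rewrite /lp_trunc; case: ifP => // _; rewrite modulus0 modulus_ge0. Qed.

Lemma ler_lp_norm_trunc M M' y : (M <= M')%N ->
  lp_norm p (lp_trunc M y) <= lp_norm p (lp_trunc M' y).
Proof.
move=> MM'; apply: ler_lp_norm => [|n]; first exact: lp_sum_trunc_lty.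
rewrite /lp_trunc; case: ifPn => nM; first by rewrite (leq_trans nM).
by rewrite modulus0 modulus_ge0.
Qed.

(** With [ler_lp_norm_trunc], this says that the norm is the supremum of its
truncations. *)
Lemma lp_norm_le_trunc y s : (forall M, lp_norm p (lp_trunc M y) <= s) ->
  lp_norm p y <= s.
Proof.
move=> ys; have s0 : 0 <= s by rewrite (le_trans _ (ys 0%N))// lp_norm_ge0.
have : (lp_sum p y <= (s `^ p)%:E)%E.
  apply: lime_le; first by apply: is_cvg_nneseries => n _ _; exact: term_ge0.
  apply: nearW => M; rewrite sumEFin lee_fin.
  have -> : \sum_(0 <= n < M) modulus (y n) `^ p = lp_norm p (lp_trunc M y) `^ p.
    by rewrite lp_norm_powR lp_sum_trunc.
  by rewrite ge0_ler_powR ?nnegrE ?lp_norm_ge0 ?(ltW p0).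
move=> ysp; rewrite -[leRHS](powRr1 s0) -(mulfV pn0) powRrM.
apply: ge0_ler_powR; rewrite ?invr_ge0 ?(ltW p0)//.
- by rewrite nnegrE fine_ge0// lp_sum_ge0.
- by rewrite nnegrE powR_ge0.
- by rewrite -lee_fin fineK// lp_sum_fin_num// (le_lt_trans ysp)// ltry.
Qed.

Lemma lp_norm_trunc0 y : lp_norm p (lp_trunc 0 y) = 0.
Proof. by rewrite /lp_norm lp_sum_trunc big_nil powR0// invr_eq0. Qed.

(** Bounds the truncated norms by finitely many coordinates, which makes them
weakly continuous. *)
Lemma lp_norm_truncS M y :
  lp_norm p (lp_trunc M.+1 y) <= lp_norm p (lp_trunc M y) + modulus (y M).
Proof.
pose e := lp_trunc M.+1 y \- lp_trunc M y.
have eE n : e n = if n == M then y M else 0.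
  rewrite /e/= /lp_trunc ltnS; have [nM|nM|->] := ltngtP n M.
  - by rewrite subrr.
  - by rewrite subr0.
  - by rewrite subr0.
have esum : lp_sum p e = (modulus (y M) `^ p)%:E.
  rewrite /lp_sum (@nneseriesD1 _ _ M)//.
  rewrite eE eqxx eseries0 ?adde0// => n _ /= nM.
  by rewrite eE (negbTE nM) modulus0 powR0.
have -> : lp_trunc M.+1 y = lp_trunc M y \+ e.
  by apply/funext => n; rewrite /= addrC subrK.
have ey : (lp_sum p e < +oo)%E by rewrite esum ltry.
apply: le_trans (ler_lp_normD p1 (lp_sum_trunc_lty M y) ey) _.
by rewrite lerD2l /lp_norm esum/= -powRrM mulfV// powRr1// modulus_ge0.
Qed.

Lemma modulus_le_lp_norm y n : (lp_sum p y < +oo)%E ->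
  modulus (y n) <= lp_norm p y.
Proof.
move=> yp; rewrite -[leLHS](powRr1 (modulus_ge0 (y n))) -(mulfV pn0) powRrM.
apply: ge0_ler_powR; rewrite ?invr_ge0 ?(ltW p0) ?nnegrE ?powR_ge0//.
- by rewrite fine_ge0// lp_sum_ge0.
- rewrite -lee_fin fineK ?lp_sum_fin_num//.
  rewrite /lp_sum (@nneseriesD1 _ _ n)//.
  by rewrite leeDl//; apply: nneseries_ge0 => k _ _; exact: term_ge0.
Qed.

End TruncatedNorms.

Section LpUniformConvexity.
Context {R : realType} {F : scalars R} (p : R) (p1 : 1 < p).
Context (paraF : parallelogram_law F).
Implicit Types y z : nat -> F.

Let lp_norm_combination (c K : R) (y z d m : nat -> F) : 0 <= c -> 0 <= K ->
  (lp_sum p y < +oo)%E -> (lp_sum p z < +oo)%E ->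
  (lp_sum p d < +oo)%E -> (lp_sum p m < +oo)%E ->
  (forall n, modulus (d n) `^ p + K * modulus (m n) `^ p <=
    c * (modulus (y n) `^ p + modulus (z n) `^ p)) ->
  lp_norm p d `^ p + K * lp_norm p m `^ p <=
  c * (lp_norm p y `^ p + lp_norm p z `^ p).
Proof.
move=> c0 K0 yp zp dp mp dm.
suff : fine (lp_sum p d) + K * fine (lp_sum p m) <=
    c * (fine (lp_sum p y) + fine (lp_sum p z)).
  by rewrite -!(lp_norm_powR (ltW p1)).
rewrite -lee_fin EFinD !EFinM EFinD !fineK ?lp_sum_fin_num//.
have t0 (x : nat -> F) n : (0 <= (modulus (x n) `^ p)%:E)%E.
  by rewrite lee_fin powR_ge0.
rewrite /lp_sum -nneseriesZl => [|n _]; last exact: t0.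
rewrite -!nneseriesD => [|n _ _|n _ _|n _ _|n _ _]; rewrite ?mule_ge0//.
rewrite -nneseriesZl => [|n _]; last by rewrite adde_ge0.
apply: lee_nneseries => [n _ _|n _].
  by rewrite adde_ge0// mule_ge0.
by rewrite -EFinM -!EFinD -EFinM lee_fin.
Qed.

(** [powR_uniform_convexity] for the scalars y n and z n, summed over n. *)
Lemma lp_norm_uniform_convexity eta : 0 < eta ->
  exists2 K, 0 < K & forall y z,
    (lp_sum p y < +oo)%E -> (lp_sum p z < +oo)%E ->
    lp_norm p (fun n => y n - z n) `^ p +
      K * lp_norm p (fun n => ofreal F 2^-1 * (y n + z n)) `^ p <=
    (eta + K / 2) * (lp_norm p y `^ p + lp_norm p z `^ p).
Proof.
move=> eta0; have [K K0 KP] := powR_uniform_convexity p1 eta0.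
exists K; first exact: K0.
move=> y z yp zp.
apply: lp_norm_combination => [||||||n].
- by rewrite addr_ge0 ?(ltW eta0)// divr_ge0// ltW.
- exact: ltW.
- exact: yp.
- exact: zp.
- have := lp_sumD (ltW p1) yp (lp_sumZ (-1) zp).
  by congr (lp_sum p _ < +oo)%E; apply/funext => n /=; rewrite mulN1r.
- exact: lp_sumZ (lp_sumD (ltW p1) yp zp).
apply: KP.
- exact: modulus_ge0.
- exact: modulus_ge0.
- exact: modulus_ge0.
- have := ler_modulusD (y n - z n) (z n); rewrite subrK.
  have := ler_modulusD (z n - y n) (y n); rewrite subrK modulusB ler_norml.
  by move=> ? ?; apply/andP; split; lra.
- have := ler_modulusD (y n) (- z n).
  suff -> : modulus (- z n) = modulus (z n) by [].
  by have := modulusB (z n) 0; rewrite sub0r subr0.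
- rewrite -paraF modulusM modulus_ofreal ger0_norm ?invr_ge0//.
  by field.
Qed.

End LpUniformConvexity.

(** * Cluster points of weakly compact sets *)

Section WeakCluster.
Context {K : numFieldType} (X : normedModType K) (phi : nat -> dual X).

Lemma nbhs_weak_coordinates (c : X) M (e : K) : 0 < e ->
  nbhs (c : weak_topology X)
    [set u : weak_topology X |
      forall n, (n < M)%N -> `|sval (phi n) ((u : X) - c)| < e].
Proof.
move=> e0; elim: M => [|M IH]; first exact: filterS filterT.
have phic : {for (c : weak_topology X),
    continuous (fun u : weak_topology X => sval (phi M) (u : X) : K^o)}.
  apply: (@continuous_comp _ _ _
    (fun u : weak_topology X =>
      (fun f : dual X => sval f (u : X)) : {ptws dual X -> K^o})
    (fun g : {ptws dual X -> K^o} => g (phi M))).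
    exact: initial_continuous.
  (* the evaluation lemma wants a decidable index type *)
  exact: (@proj_continuous {classic (dual X)} (fun=> K^o) (phi M)).
have /cvgrPdist_lt /(_ e e0) near_c := phic.
apply: filterS (filterI IH near_c) => u [uM /= uc] n.
rewrite ltnS leq_eqVlt => /predU1P[->|]; last exact: uM.
by rewrite linearB distrC.
Qed.

Lemma weakly_compact_cluster (C : set X) (x : nat -> X) :
  weakly_compact C -> (forall j, C (x j)) ->
  exists2 c, C c & forall M (e : K) k, 0 < e ->
    exists2 j, (k <= j)%N &
      forall n, (n < M)%N -> `|sval (phi n) (x j - c)| < e.
Proof.
move=> wC Cx.
have [] := wC ((x : nat -> weak_topology X) @ \oo) _ _.
  by exists 0%N => // j _; exact: Cx.
move=> c [Cc cl]; exists c => // M e k e0.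
have [|u [[j kj <-] uc]] := cl [set x j | j in [set j | (k <= j)%N]] _ _
  (nbhs_weak_coordinates c M e0).
  by exists k => // j kj; exists j.
by exists j.
Qed.

End WeakCluster.

(** * The Taylor space as a real normed space *)

Section TaylorCoordinates.
Context {R : realType} (F : scalars R) (r p : R) (p1 : 1 <= p).
Local Notation X := (taylor_space F r p1).
Implicit Types u v : X.

Definition taylor_coord u : nat -> F := taylor r (val (repr u)).

Let definedP (x : taylor_seq F r p1) : taylor_defined r (val x).
Proof. by have /in_taylorP[] := valP x. Qed.

Lemma coord_lp u : (lp_sum p (taylor_coord u) < +oo)%E.
Proof. by have /in_taylorP[] := valP (repr u). Qed.

Lemma norm_coord u : `|u| = ofreal F (lp_norm p (taylor_coord u)).
Proof. by []. Qed.

(** Two representatives of a class differ by a sequence of seminorm 0, whose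
transform vanishes. *)
Let coord_class (x : taylor_seq F r p1) :
  taylor_coord (taylor_class x) = taylor r (val x).
Proof.
have /taylor_class_eq := taylor_class_repr (taylor_class x).
set y := repr (taylor_class x) => yx.
have dN : taylor_defined r (-1 *: val x) by exact: taylor_definedZ.
have yxE : val (y - x) = val y + -1 *: val x.
  by rewrite raddfB scaleN1r.
have E : taylor r (val (y - x)) = (fun n => taylor r (val y) n - taylor r (val x) n).
  rewrite yxE (taylorD (@definedP y) dN) (taylorZ _ (@definedP x)).
  by apply/funext => n /=; rewrite mulN1r.
apply/funext => n; apply/eqP; rewrite -subr_eq0; apply/eqP/modulus_eq0/le_anti.
rewrite modulus_ge0 andbT -yx /taylor_norm.
have /in_taylorP[_ lt] := valP (y - x).
by have := modulus_le_lp_norm p1 n lt; rewrite E.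
Qed.

Lemma coordD u v : taylor_coord (u + v) = taylor_coord u \+ taylor_coord v.
Proof.
have -> : u + v = taylor_class (repr u + repr v).
  rewrite -[LHS](congr2 +%R (taylor_class_repr u) (taylor_class_repr v)).
  by symmetry; exact: Quotient.pi_add.
by rewrite coord_class raddfD/= (taylorD (@definedP _) (@definedP _)).
Qed.

Lemma coordZ a u : taylor_coord (a *: u) = fun n => a * taylor_coord u n.
Proof.
have -> : a *: u = taylor_class (a *: repr u) by [].
by rewrite coord_class linearZ/= (taylorZ _ (@definedP _)).
Qed.

Definition coord_at n u : F^o := taylor_coord u n.

Let coord_at_linear n : linear (coord_at n).
Proof. by move=> a u v; rewrite /coord_at coordD coordZ. Qed.

HB.instance Definition _ n := GRing.isLinear.Build F X F^o *:%R (coord_at n)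
  (coord_at_linear n).

Lemma coord_at_continuous n : continuous (coord_at n).
Proof.
apply: bounded_linear_continuous; apply/linear_boundedP.
near=> k => u.
rewrite (@le_trans _ _ `|u|)//.
  by rewrite norm_coord [leLHS]modulusE ler_ofreal modulus_le_lp_norm// coord_lp.
by rewrite ler_peMl//; near: k; apply: nbhs_pinfty_ge; exact: real1.
Unshelve. all: by end_near. Qed.

Definition coord_dual n : dual X :=
  exist _ (coord_at n : {linear X -> F^o}) (@coord_at_continuous n).

(** Restriction of scalars: uniform convexity and nonexpansive maps are matters
of the real normed space, whose norm takes its values in R itself. *)
Definition real_taylor : Type := X.

HB.instance Definition _ := GRing.Zmodule.on real_taylor.

Definition scale_real (a : R) (u : real_taylor) : real_taylor :=
  ofreal F a *: (u : X).

Let scale_realA a b u : scale_real a (scale_real b u) = scale_real (a * b) u.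
Proof. by rewrite /scale_real scalerA rmorphM. Qed.

Let scale_real1 : left_id 1 scale_real.
Proof. by move=> u; rewrite /scale_real rmorph1 scale1r. Qed.

Let scale_realDr : right_distributive scale_real +%R.
Proof. by move=> a u v; exact: scalerDr. Qed.

Let scale_realDl u : {morph scale_real^~ u : a b / a + b}.
Proof. by move=> a b; rewrite /scale_real rmorphD scalerDl. Qed.

HB.instance Definition _ := GRing.Zmodule_isLmodule.Build R real_taylor
  scale_realA scale_real1 scale_realDr scale_realDl.

Definition real_norm (u : real_taylor) : R := lp_norm p (taylor_coord u).

Let real_normD (u v : real_taylor) :
  real_norm (u + v) <= real_norm u + real_norm v.
Proof.
have := ler_normD (u : X) (v : X).
by rewrite !norm_coord -rmorphD ler_ofreal.
Qed.

Let real_normZ a (u : real_taylor) : real_norm (a *: u) = `|a| * real_norm u.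
Proof.
have := normrZ (ofreal F a) (u : X).
rewrite [X in X * _]modulusE modulus_ofreal !norm_coord -rmorphM.
exact: ofreal_inj.
Qed.

Let real_norm0 (u : real_taylor) : real_norm u = 0 -> u = 0.
Proof.
move=> u0; apply: (@normr0_eq0 _ X).
rewrite norm_coord; transitivity (ofreal F 0); last exact: rmorph0.
exact: (congr1 (ofreal F) u0).
Qed.

HB.instance Definition _ := Lmodule_isNormed.Build R real_taylor
  real_normD real_normZ real_norm0.

Lemma norm_realE (u : real_taylor) : `|u| = lp_norm p (taylor_coord u).
Proof. by []. Qed.

End TaylorCoordinates.

(** * The weak fixed point property *)

Section TaylorFixedPoint.
Context {R : realType} (F : scalars R) (r p : R) (p1 : 1 < p).
Context (paraF : parallelogram_law F).
Local Notation X := (taylor_space F r (ltW p1)).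
Local Notation E := (real_taylor F r (ltW p1)).

Lemma coordZr (a : R) (u : E) :
  taylor_coord (a *: u : X) = fun n => ofreal F a * taylor_coord u n.
Proof. exact: coordZ. Qed.

Lemma real_taylor_uniformly_convex : uniformly_convex E.
Proof.
apply: (uniformly_convex_powR p1) => eta eta0.
have [K K0 KP] := lp_norm_uniform_convexity p1 paraF eta0.
exists K => [//|u v].
have -> : `|u - v| = lp_norm p (fun n => taylor_coord u n - taylor_coord v n).
  rewrite norm_realE -[- v]scaleN1r; congr (lp_norm p _).
  rewrite (coordD (u : X) _); apply/funext => n /=; rewrite coordZr.
  by rewrite rmorphN rmorph1 mulN1r.
have -> : `|2^-1 *: (u + v)| =
    lp_norm p (fun n => ofreal F 2^-1 * (taylor_coord u n + taylor_coord v n)).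
  rewrite norm_realE; congr (lp_norm p _).
  by rewrite coordZr; apply/funext => n /=; rewrite (coordD (u : X)).
by have := KP _ _ (coord_lp u) (coord_lp v).
Qed.

Definition trunc_norm M (u : E) : R := lp_norm p (lp_trunc M (taylor_coord u)).

Lemma trunc_normD M u v : trunc_norm M (u + v) <= trunc_norm M u + trunc_norm M v.
Proof.
rewrite /trunc_norm (coordD (u : X)) lp_truncD.
by apply: ler_lp_normD; rewrite ?lp_sum_trunc_lty// ltW.
Qed.

Lemma trunc_normZ M a u : trunc_norm M (a *: u) = `|a| * trunc_norm M u.
Proof.
rewrite /trunc_norm coordZr lp_truncZ lp_normZ ?modulus_ofreal//.
  exact: lt_trans p1.
by rewrite lp_sum_trunc_lty// ltW.
Qed.

Lemma trunc_norm_le M u : trunc_norm M u <= `|u|.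
Proof.
rewrite norm_realE; apply: ler_lp_norm (ltW p1) _ _ (coord_lp u) _ => n.
exact: modulus_trunc.
Qed.

Lemma trunc_norm_mono M M' u : (M <= M')%N -> trunc_norm M u <= trunc_norm M' u.
Proof. exact: ler_lp_norm_trunc (ltW p1) _ _ _. Qed.

Lemma norm_le_trunc_norm u s : (forall M, trunc_norm M u <= s) -> `|u| <= s.
Proof. by rewrite norm_realE; exact: lp_norm_le_trunc (ltW p1) _ _. Qed.

Lemma trunc_norm_le_coord M (u : E) b :
  (forall n, (n < M)%N -> modulus (taylor_coord u n) <= b) -> trunc_norm M u <= M%:R * b.
Proof.
rewrite /trunc_norm; elim: M => [|M IH] ub.
  by rewrite (lp_norm_trunc0 (ltW p1)) mul0r.
rewrite (le_trans (lp_norm_truncS (ltW p1) M _))// -natr1 mulrDl mul1r lerD//.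
  by apply: IH => n nM; apply: ub; exact: ltnW.
exact: ub.
Qed.

Lemma weakly_compact_trunc_norm (C : set X) :
  weakly_compact C -> seminorms_compact trunc_norm (C : set E).
Proof.
move=> wC x Cx.
have [c Cc cP] := weakly_compact_cluster
  (@coord_dual R F r p (ltW p1)) wC Cx.
exists c => // M e k e0.
(* M coordinates of modulus at most b add up to less than e *)
pose b := e / M.+1%:R.
have b0 : 0 < b by rewrite divr_gt0.
have Fb0 : 0 < ofreal F b.
  by rewrite lt_neqAle -{2}(rmorph0 (ofreal F)) ler_ofreal (ltW b0) andbT
    eq_sym fmorph_eq0 gt_eqF.
have [j kj jP] := cP M _ k Fb0; exists j => //.
apply: (@le_lt_trans _ _ (M%:R * b)).
  apply: trunc_norm_le_coord => n nM; have := ltW (jP n nM).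
  by rewrite modulusE ler_ofreal.
by rewrite mulrCA -[ltRHS]mulr1 ltr_pM2l// ltr_pdivrMr// mul1r ltr_nat.
Qed.

Theorem taylor_space_weak_fixed_point : weak_fixed_point_property X.
Proof.
move=> C f C0 wC cC Cf nf.
have kC := weakly_compact_trunc_norm wC.
have cE : convex_set (C : set E).
  apply/convex_setP => x y t Cx Cy t0 t1; move/convex_setP: cC => cC.
  have := cC x y (ofreal F t) Cx Cy.
  rewrite -(rmorph0 (ofreal F)) -(rmorph1 (ofreal F)) -rmorphB !ler_ofreal.
  exact.
have bC : norm_bounded (C : set E).
  exact: (@convex_compact_norm_bounded R E trunc_norm trunc_normD trunc_normZ
    trunc_norm_le trunc_norm_mono norm_le_trunc_norm C cE kC).
have completeC : cauchy_complete (C : set E).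
  exact: (@compact_cauchy_complete R E trunc_norm trunc_normD trunc_norm_le
    norm_le_trunc_norm C kC).
have nfE : nonexpansive_on (C : set E) f.
  move=> x y Cx Cy.
  have := nf x y Cx Cy; rewrite [leLHS]norm_coord [leRHS]norm_coord.
  rewrite ler_ofreal; exact.
exact: (browder_goehde real_taylor_uniformly_convex C0 cE bC completeC Cf nfE).
Qed.

End TaylorFixedPoint.

Lemma real_parallelogram (R : realType) : parallelogram_law (real_scalars R).
Proof.
by move=> a b; rewrite /= !real_normK ?num_real//; ring.
Qed.

Lemma complex_parallelogram (R : realType) :
  parallelogram_law (complex_scalars R).
Proof.
move=> [a a'] [b b'].
rewrite /= !sqr_sqrtr ?addr_ge0 ?sqr_ge0//; ring.
Qed.

Theorem corollary3p4 (R : realType) (r p : R)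
    (r_gt0 : 0 < r) (r_lt1 : r < 1) (p_gt1 : 1 < p) :
  weak_fixed_point_property (taylor_space (real_scalars R) r (ltW p_gt1)) /\
  weak_fixed_point_property (taylor_space (complex_scalars R) r (ltW p_gt1)).
Proof.
split; apply: taylor_space_weak_fixed_point.
- exact: real_parallelogram.
- exact: complex_parallelogram.
Qed.
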